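(* Assume that the kernels satisfy $0\le k^j(x,x')\le K^j$ for all $x,x'\in\mathbb X^j$ and $j\in[d]$. For any $\alpha\in(0,1)$, $$\mathbb P_{\boldsymbol\pi}\Big(\widehat{\mathrm{dHSIC}}(\mathcal X_n^{\boldsymbol\pi})\ge C\sqrt{\frac{\prod_{j=1}^dK^j}{n}}\,\max\Big\{\log^{1/4}\Big(\frac1\alpha\Big),\log^{1/2}\Big(\frac1\alpha\Big),1\Big\}\ \Big|\ \mathcal X_n\Big)\le\alpha,$$ where $C$ is some positive constant.
   Context: Superscripts $j\in[d]=\{1,\dots,d\}$ on $k$, $K$, $X$, $\pi$ are indices, not exponents. $d\ge2$ is fixed, and the constant $C$ does not depend on $n$, $\alpha$ or the data. For each $j$, $\mathbb X^j$ is a separable topological space and $k^j:\mathbb X^j\times\mathbb X^j\to\mathbb R$ is a continuous, bounded, positive semi-definite kernel with RKHS $\mathcal H^j$. The tensor product kernel $\mathbf k((x^j)_j,(x'^j)_j)=\prod_{j}k^j(x^j,x'^j)$, with RKHS $\mathcal H_{\mathbf k}=\mathcal H^1\otimes\dots\otimes\mathcal H^d$ and unit ball $\mathcal F_{\mathbf k}$, is assumed characteristic. For a dataset $\mathcal X_n=(\mathbf X_1,\dots,\mathbf X_n)$, $\mathbf X_i=(X_i^1,\dots,X_i^d)$, $$\widehat{\mathrm{dHSIC}}(\mathcal X_n)=\sup_{f\in\mathcal F_{\mathbf k}}\Big\{\frac1n\sum_{i=1}^nf(X_i^1,\dots,X_i^d)-\frac1{n^d}\sum_{(i_1,\dots,i_d)\in[n]^d}f(X_{i_1}^1,\dots,X_{i_d}^d)\Big\}.$$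 $\boldsymbol\pi=(\pi^1,\dots,\pi^d)$ is a $d$-tuple of permutations of $[n]$ drawn uniformly at random, independently of $\mathcal X_n$; $\mathcal X_n^{\boldsymbol\pi}$ has $i$-th element $(X^1_{\pi^1(i)},\dots,X^d_{\pi^d(i)})$; $\mathbb P_{\boldsymbol\pi}(\cdot\mid\mathcal X_n)$ is the probability over $\boldsymbol\pi$ with the data fixed.
   Formalization: The bounds K^j are assumed strictly positive: if some K^j = 0, the threshold is 0 and the statistic is 0, so the displayed probability is 1 and the claim fails. *)

(* Defs.v *)
From HB Require Import structures.
From mathcomp Require Export all_boot all_order all_algebra all_fingroup.
From mathcomp Require Export all_classical all_reals all_analysis.
Export Order.TTheory GRing.Theory Num.Theory.
Export numFieldNormedType.Exports.

Set Implicit Arguments.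
Unset Strict Implicit.
Unset Printing Implicit Defensive.

Local Open Scope classical_set_scope.
Local Open Scope ring_scope.

Definition separable (T : topologicalType) : Prop :=
  exists2 D : set T, countable D & dense D.

Definition positive_semidefinite (R : realType) (T : Type) (k : T -> T -> R) :
    Prop :=
  (forall x y, k x y = k y x) /\
  (forall (m : nat) (c : 'I_m -> R) (x : 'I_m -> T),
     0 <= \sum_(i < m) \sum_(j < m) c i * c j * k (x i) (x j)).

(* A reproducing kernel Hilbert space of [k]: a real Hilbert space whose
   elements are functions on [T] ([rkhs_eval] is linear and injective),
   containing the sections [k x] and satisfying f x = <f, k x>.
   By the Moore-Aronszajn theorem it exists for every positive semi-definite
   [k] and is unique up to an isometry commuting with [rkhs_eval]. *)
Record rkhs (R : realType) (T : Type) (k : T -> T -> R) := Rkhs {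
  rkhs_space :> completeNormedModType R ;
  rkhs_dot : {dot rkhs_space for idfun} ;
  rkhs_normE : forall f : rkhs_space, `|f| ^+ 2 = rkhs_dot f f ;
  rkhs_eval : rkhs_space -> T -> R ;
  rkhs_eval_linear : forall (a : R) (f g : rkhs_space) (x : T),
    rkhs_eval (a *: f + g) x = a * rkhs_eval f x + rkhs_eval g x ;
  rkhs_eval_inj : injective rkhs_eval ;
  rkhs_section : T -> rkhs_space ;
  rkhs_sectionE : forall x y : T, rkhs_eval (rkhs_section x) y = k x y ;
  rkhs_reproducing : forall (f : rkhs_space) (x : T),
    rkhs_eval f x = rkhs_dot f (rkhs_section x)
}.

Definition rkhs_unit_ball (R : realType) (T : Type) (k : T -> T -> R)
    (H : rkhs k) : set (T -> R) :=
  [set rkhs_eval f | f in [set f : H | `|f| <= 1]].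

HB.instance Definition _ (I : Type) (T : I -> ptopologicalType) :=
  isPointed.Build (prod_topology T) (fun=> point).

Notation borelType T := (g_sigma_algebraType (@open T)).

Definition mean_embedding (R : realType) (T : ptopologicalType)
    (k : T -> T -> R) (P : probability (borelType T) R) : T -> R :=
  fun x => (\int[P]_(y in [set: borelType T]) k x y)%R.

(* Elements of [probability _ _] also record values on non-measurable sets,
   hence equality of [P] and [Q] on the Borel sets only. *)
Definition characteristic (R : realType) (T : ptopologicalType)
    (k : T -> T -> R) : Prop :=
  forall P Q : probability (borelType T) R,
    mean_embedding k P = mean_embedding k Q ->
    forall A : set (borelType T), measurable A -> P A = Q A.

Definition tensor_kernel (R : realType) (d : nat) (X : 'I_d -> ptopologicalType)
    (k : forall j, X j -> X j -> R) : prod_topology X -> prod_topology X -> R :=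
  fun x y => \prod_(j < d) k j (x j) (y j).

Definition dHSIC (R : realType) (d : nat) (X : 'I_d -> ptopologicalType)
    (k : forall j, X j -> X j -> R) (H : rkhs (tensor_kernel k)) (n : nat)
    (x : 'I_n -> prod_topology X) : R :=
  sup [set n%:R^-1 * (\sum_(i < n) f (x i))
           - (n ^ d)%:R^-1 *
             (\sum_(i : {ffun 'I_d -> 'I_n}) f (fun j => x (i j) j))
      | f in rkhs_unit_ball H].

Definition permute_data (d : nat) (X : 'I_d -> ptopologicalType) (n : nat)
    (pi : {ffun 'I_d -> 'S_n}) (x : 'I_n -> prod_topology X) :
    'I_n -> prod_topology X :=
  fun i j => x (pi j i) j.

(* Probability of [E] under the uniform law on d-tuples of permutations. *)
Definition perm_prob (R : realType) (d n : nat)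
    (E : pred {ffun 'I_d -> 'S_n}) : R :=
  #|E|%:R / #|{: {ffun 'I_d -> 'S_n}}|%:R.

(* Main.v *)
Require Import Defs.
From mathcomp Require Import ring lra.

Set Implicit Arguments.
Unset Strict Implicit.
Unset Printing Implicit Defensive.

Local Open Scope classical_set_scope.
Local Open Scope ring_scope.

(** The statistic is at most the Hilbert norm of v(pi) - mu, where v(pi) is the
    mean of the features of the permuted sample and mu, the mean of the features
    of all n^d recombined points, is unchanged by permutations. With
    s = sqrt (prod K / n), the norm is of order s on average and has sub-Gaussian
    fluctuations of the same order, so a threshold C s M with M >= 1 is exceeded
    with probability at most exp (- M^2). The maximum in the theorem is such an
    M, and M^2 >= ln (1/alpha) because of its power 1/2.

    Mean. Each recombined point is equally likely to be the i-th permuted point,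
    so v has mean mu and E |v - mu|^2 = E |v|^2 - |mu|^2. Expanding E |v|^2 into
    Gram entries, the n diagonal pairs give at most (prod K) / n. For a pair
    i <> i', the entry factors over the coordinates; by 2-transitivity each factor
    is the average of k^j over the off-diagonal sample pairs, which positive
    semi-definiteness bounds by the average over all pairs. As the kernels are
    nonnegative the factors multiply up to |mu|^2. Hence E |v - mu|^2 <= s^2
    ([sum_sqr_norm_permuted_le]).

    Fluctuations. Composing one coordinate of pi with a transposition changes two
    terms of v, hence the norm by at most D = 4 sqrt (prod K) / n
    ([joint_embedding_lipschitz]). The tuples of permutations that fix all pairs
    (coordinate, point) from some rank on form a chain of d n subgroups, each
    obtained from the preceding one by such transpositions. Averaging the
    statistic over this growing chain is a martingale with increments bounded by
    D, and the Hoeffding argument yields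
    E exp (l f) <= exp (l E f + 2 d n l^2 D^2)
    ([group_chain_mgf_le], [perm_tuples_mgf_le]).
    Since d n D^2 = 16 d s^2, the Chernoff bound with l = M / s closes the
    proof ([dHSIC_perm_tail]). *)

(** * Exponential moments of bounded finite families *)

(** Averaging this over a centered y kills the linear term and leaves a
    sub-Gaussian bound. For y <= 1 the right-hand side dominates the quadratic
    1 + y + 2 y^2, and exp is bounded by inverting 1 - z <= exp (- z). *)
Lemma expR_le_add_expR_sqr (R : realType) (y : R) :
  expR y <= y + expR (2 * y ^+ 2).
Proof.
suff quadratic : y <= 1 -> expR y <= 1 + y + 2 * y ^+ 2.
  have [/quadratic y_small|y_large] := leP y 1.
    apply: (le_trans y_small); have := expR_ge1Dx (2 * y ^+ 2); lra.
  have : expR y <= expR (2 * y ^+ 2) by rewrite ler_expR; nra.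
  lra.
move=> y_le1.
have inv_bound (z : R) : z < 1 -> expR z <= (1 - z)^-1.
  move=> z_lt1; rewrite -[z in expR z]opprK expRN lef_pV2 ?posrE ?expR_gt0 //.
    by have := expR_ge1Dx (- z).
  by rewrite subr_gt0.
have [y_le0|y_gt0] := leP y 0.
  apply: (le_trans (inv_bound y _)); first by lra.
  rewrite -[_^-1]mul1r ler_pdivrMr; nra.
(* Inverting at y instead of y / 2 would blow up as y tends to 1. *)
have -> : expR y = expR (y / 2) ^+ 2 by rewrite -expRM_natl; congr expR; lra.
apply: (@le_trans _ _ ((1 - y / 2)^-1 ^+ 2)).
  by rewrite lerXn2r ?nnegrE ?expR_ge0 ?invr_ge0 ?inv_bound //; lra.
have sqr_gt0 : 0 < (1 - y / 2) ^+ 2 by apply: exprn_gt0; lra.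
rewrite exprVn -(ler_pM2r sqr_gt0) mulVf ?gt_eqF //.
suff : 0 <= y ^+ 2 * ((1 - y) * (5 / 2 - y)) by lra.
by rewrite mulr_ge0 ?sqr_ge0 // mulr_ge0 //; lra.
Qed.

Lemma finite_hoeffding (R : realType) (T : finType) (A : {set T}) (a : T -> R)
    (l D : R) :
  A != finset.set0 ->
  {in A &, forall u v, `|a u - a v| <= D} ->
  \sum_(u in A) expR (l * a u) <=
    #|A|%:R * expR (l * ((\sum_(u in A) a u) / #|A|%:R) + 2 * l ^+ 2 * D ^+ 2).
Proof.
move=> A_neq0 a_osc.
have A_gt0 : 0 < #|A|%:R :> R by rewrite ltr0n card_gt0.
set m := (\sum_(u in A) a u) / _.
have sum_m : \sum_(u in A) (a u - m) = 0.
  by rewrite sumrB sumr_const -[m *+ _]mulr_natr /m divfK ?subrr ?gt_eqF.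
have a_dev u : u \in A -> `|a u - m| <= D.
  move=> uA.
  have -> : a u - m = (\sum_(v in A) (a u - a v)) / #|A|%:R.
    by rewrite sumrB sumr_const -[a u *+ _]mulr_natr mulrBl mulfK // gt_eqF.
  rewrite normrM normfV (gtr0_norm A_gt0) ler_pdivrMr //.
  apply: (le_trans (ler_norm_sum _ _ _)).
  rewrite mulr_natr -sumr_const; apply: ler_sum => v vA; exact: a_osc.
apply: (@le_trans _ _ (\sum_(u in A)
    expR (l * m) * (l * (a u - m) + expR (2 * l ^+ 2 * D ^+ 2)))).
  apply: ler_sum => u uA.
  have -> : l * a u = l * m + l * (a u - m) by ring.
  rewrite expRD ler_wpM2l ?expR_ge0 //.
  apply: (le_trans (expR_le_add_expR_sqr _)).
  rewrite lerD2l ler_expR exprMn -mulrA !ler_wpM2l ?sqr_ge0 //.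
  have := a_dev u uA; rewrite ler_norml; nra.
rewrite -big_distrr big_split /= -big_distrr /= sum_m mulr0 add0r.
by rewrite sumr_const expRD [X in _ <= X]mulrCA -[X in _ * X <= _]mulr_natl.
Qed.

(** * Concentration along a chain of subgroups *)

Section GroupConcentration.
Variables (R : realType) (gT : finGroupType).
Implicit Types (H K : {group gT}) (f : gT -> R).

Definition rcoset_mean H f (g : gT) : R :=
  (\sum_(h in H) f (h * g)%g) / #|H|%:R.

Let card_neq0 H : #|H|%:R != 0 :> R.
Proof. by rewrite pnatr_eq0 -lt0n cardG_gt0. Qed.

Lemma rcoset_mean_tower H K f g : H \subset K ->
  rcoset_mean K f g = (\sum_(k in K) rcoset_mean H f (k * g)%g) / #|K|%:R.
Proof.
move=> sHK; rewrite /rcoset_mean -big_distrl /=; congr (_ / _).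
rewrite exchange_big /= -[LHS](mulfK (card_neq0 H)); congr (_ / _).
rewrite mulr_natr -sumr_const; apply: eq_bigr => h hH.
rewrite [LHS](reindex_inj (mulgI h)) /=.
have hK := fintype.subsetP sHK h hH.
by apply: eq_big => [k|k _]; rewrite ?groupMl ?mulgA.
Qed.

(** One martingale step. Averaging the mean over H along the right cosets of K
    gives the mean over K. On such a coset the mean over H oscillates by at most
    D: two elements of K differ by some h b with h in H and b in B, the factor h
    is absorbed by the mean, and B is stable under conjugation, so moving b
    past the elements of H costs at most D on each term. *)
Lemma sum_expR_rcoset_mean_le H K (B : {set gT}) f (l D : R) :
  H \subset K -> K \subset (H * B)%g ->
  {in B, forall b (g : gT), (b ^ g)%g \in B} ->
  {in B, forall b g, `|f (b * g)%g - f g| <= D} ->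
  \sum_g expR (l * rcoset_mean H f g) <=
    expR (2 * l ^+ 2 * D ^+ 2) * \sum_g expR (l * rcoset_mean K f g).
Proof.
move=> sHK sKHB conjB f_osc.
have mean_mul h g : h \in H -> rcoset_mean H f (h * g)%g = rcoset_mean H f g.
  move=> hH; rewrite /rcoset_mean; congr (_ / _).
  rewrite [RHS](reindex_inj (mulIg h)) /=.
  by apply: eq_big => [k|k _]; rewrite ?groupMr ?mulgA.
have mean_osc b g : b \in B -> `|rcoset_mean H f (b * g)%g - rcoset_mean H f g| <= D.
  move=> bB; rewrite /rcoset_mean -mulrBl -sumrB normrM normfV normr_nat.
  rewrite ler_pdivrMr ?ltr0n ?cardG_gt0 // (le_trans (ler_norm_sum _ _ _)) //.
  rewrite mulr_natr -sumr_const; apply: ler_sum => h hH.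
  have -> : (h * (b * g) = (b ^ h^-1) * (h * g))%g.
    by rewrite conjgE invgK -!mulgA mulKg.
  exact/f_osc/conjB.
have coset_osc g : {in K &, forall k k',
    `|rcoset_mean H f (k * g)%g - rcoset_mean H f (k' * g)%g| <= D}.
  move=> k k' kK k'K.
  have /fintype.subsetP/(_ (k * k'^-1)%g) := sKHB.
  rewrite groupM ?groupV // => /(_ isT) /mulsgP[h b hH bB kk'].
  have -> : (k * g = h * (b * (k' * g)))%g.
    by rewrite mulgA -kk' -!mulgA mulKg.
  by rewrite mean_mul // mean_osc.
have coset_sum (F : gT -> R) :
    \sum_g F g = (\sum_g \sum_(k in K) F (k * g)%g) / #|K|%:R.
  rewrite exchange_big /= -[LHS](mulfK (card_neq0 K)); congr (_ / _).
  rewrite mulr_natr -sumr_const; apply: eq_bigr => k _.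
  by rewrite [LHS](reindex_inj (mulgI k)).
rewrite coset_sum ler_pdivrMr ?ltr0n ?cardG_gt0 // mulrAC mulr_sumr.
apply: ler_sum => g _; apply: (le_trans (finite_hoeffding l _ (coset_osc g))).
  by apply/set0Pn; exists 1%g; rewrite group1.
by rewrite -(rcoset_mean_tower _ _ sHK) expRD; lra.
Qed.

(** The means over the groups of the chain interpolate between f, for the trivial
    group, and its average, for the whole group. *)
Theorem group_chain_mgf_le (H : nat -> {group gT}) (N : nat) (B : {set gT})
    f (l D : R) :
  H 0%N = 1%G -> H N = [set: gT]%G ->
  (forall m, H m \subset H m.+1) ->
  (forall m, (m < N)%N -> H m.+1 \subset (H m * B)%g) ->
  {in B, forall b (g : gT), (b ^ g)%g \in B} ->
  {in B, forall b g, `|f (b * g)%g - f g| <= D} ->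
  \sum_g expR (l * f g) <=
    #|gT|%:R * expR (l * ((\sum_g f g) / #|gT|%:R)
                     + 2 * N%:R * l ^+ 2 * D ^+ 2).
Proof.
move=> H0 HN sH sHB conjB f_osc.
have chain m : (m <= N)%N -> \sum_g expR (l * f g) <=
    expR (2 * m%:R * l ^+ 2 * D ^+ 2) * \sum_g expR (l * rcoset_mean (H m) f g).
  elim: m => [|m IHm] lt_mN.
    rewrite mulr0 !mul0r expR0 mul1r H0; apply: ler_sum => g _.
    by rewrite /rcoset_mean cards1 divr1 big_set1 mul1g.
  apply: (le_trans (IHm (ltnW lt_mN))).
  have := sum_expR_rcoset_mean_le l (sH m) (sHB m lt_mN) conjB f_osc.
  move=> /(ler_wpM2l (expR_ge0 (2 * m%:R * l ^+ 2 * D ^+ 2)))/le_trans; apply.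
  rewrite mulrA -expRD ler_wpM2r //.
    by apply: sumr_ge0 => g _; exact: expR_ge0.
  by rewrite ler_expR -(natr1 m); lra.
apply: (le_trans (chain N (leqnn N))).
have mean_full g : rcoset_mean (H N) f g = (\sum_g f g) / #|gT|%:R.
  rewrite /rcoset_mean HN /= cardsT [in RHS](reindex_inj (mulIg g)) /=.
  by congr (_ / _); apply: eq_bigl => h; rewrite inE.
under eq_bigr => g _ do rewrite mean_full.
by rewrite sumr_const -[X in _ * X <= _]mulr_natl [X in X <= _]mulrCA -expRD addrC.
Qed.

End GroupConcentration.

(** * The chain of subgroups in the tuples of permutations *)

Section PermutationTuples.
Variables d n : nat.
Local Notation tuples := {dffun forall j : 'I_d, 'S_n}.

Definition coordinate_transpositions : {set tuples} :=
  [set dfung1 (gT := fun _ : 'I_d => 'S_n) (i := u.1) (tperm u.2.1 u.2.2)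
  | u in [set: 'I_d * ('I_n * 'I_n)]].

(** The pair of a coordinate j and a point y has rank j n + y in the
    lexicographic order: one index lets the chain run through all coordinates. *)
Definition fixes_from (m : nat) : {set tuples} :=
  [set h : tuples | [forall j : 'I_d, [forall y : 'I_n, (m <= j * n + y)%N ==> (h j y == y)]]].

Lemma fixes_fromP m (h : tuples) :
  reflect (forall (j : 'I_d) (y : 'I_n), (m <= j * n + y)%N -> h j y = y) (h \in fixes_from m).
Proof.
rewrite inE; apply: (iffP forallP) => [fix_h j y le_m|fix_h j].
  by have /forallP/(_ y)/implyP/(_ le_m)/eqP := fix_h j.
by apply/forallP => y; apply/implyP => /fix_h->.
Qed.

Lemma group_set_fixes_from m : group_set (fixes_from m).
Proof.
apply/group_setP; split.
  by apply/fixes_fromP => j y _; rewrite oneg_ffun perm1.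
move=> g h /fixes_fromP fix_g /fixes_fromP fix_h; apply/fixes_fromP => j y le_m.
by rewrite mulg_ffun permM fix_g // fix_h.
Qed.

Canonical fixes_from_group m := Group (group_set_fixes_from m).

Lemma fixes_from0 : fixes_from_group 0 = 1%G.
Proof.
apply/val_inj/setP => h; rewrite [RHS]inE; apply/fixes_fromP/eqP => [fix_h|-> j y _].
  by apply/ffunP => j; apply/permP => y; rewrite fix_h // oneg_ffun perm1.
by rewrite oneg_ffun perm1.
Qed.

Lemma fixes_from_full : fixes_from_group (d * n) = [set: tuples]%G.
Proof.
apply/val_inj/setP => h; rewrite [RHS]inE; apply/fixes_fromP => j y.
rewrite leqNgt (leq_trans (_ : _ < j.+1 * n)%N) ?leq_mul2r ?ltn_ord ?orbT //.
by rewrite mulSn addnC ltn_add2r.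
Qed.

Lemma fixes_from_sub m : fixes_from m \subset fixes_from m.+1.
Proof.
apply/fintype.subsetP => h /fixes_fromP fix_h; apply/fixes_fromP => j y lt_m.
exact/fix_h/ltnW.
Qed.

(** The pair of rank m is (m / n, m mod n), and the transposition b of that point
    and its image by h makes h b fix it as well. *)
Lemma fixes_from_mul m : (m < d * n)%N ->
  fixes_from m.+1 \subset (fixes_from m * coordinate_transpositions)%g.
Proof.
move=> lt_m; have n_gt0 : (0 < n)%N by case: n lt_m; rewrite ?muln0.
have lt_j : (m %/ n < d)%N by rewrite ltn_divLR.
have lt_y : (m %% n < n)%N by rewrite ltn_mod.
pose j0 := Ordinal lt_j; pose y0 := Ordinal lt_y.
apply/fintype.subsetP => h /fixes_fromP fix_h.
pose b : tuples := dfung1 (gT := fun _ : 'I_d => 'S_n) (i := j0) (tperm y0 (h j0 y0)).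
have b_inv : (b * b = 1)%g.
  apply/ffunP => j; rewrite mulg_ffun oneg_ffun /b.
  have [<-|j0j] := eqVneq j0 j; first by rewrite dfung1_id tperm2.
  by rewrite dfung1_dflt // mulg1.
apply/mulsgP; exists (h * b)%g b; first last.
- by rewrite -mulgA b_inv mulg1.
- by apply/imsetP; exists (j0, (y0, h j0 y0)); rewrite ?inE.
apply/fixes_fromP => j y le_m; rewrite mulg_ffun permM.
have [j0j|j0j] := eqVneq j0 j; last first.
  rewrite /b dfung1_dflt // perm1 fix_h // ltn_neqAle le_m andbT.
  apply: contra_neq j0j => def_m; apply: val_inj => /=.
  by rewrite def_m divnMDl // divn_small ?addn0.
rewrite -{j}j0j in le_m *; rewrite /b dfung1_id.
have [->|y_neq] := eqVneq y y0; first by rewrite tpermR.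
have hy : h j0 y = y.
  rewrite fix_h // ltn_neqAle le_m andbT.
  apply: contra_neq y_neq => def_m; apply: val_inj => /=.
  by rewrite def_m modnMDl modn_small.
rewrite hy tpermD //; first by rewrite eq_sym.
by apply: contra_neq y_neq => /esym; rewrite -{1}hy => /perm_inj.
Qed.

Lemma conj_coordinate_transpositions :
  {in coordinate_transpositions, forall b (g : tuples),
     (b ^ g)%g \in coordinate_transpositions}.
Proof.
move=> _ /imsetP[[i [y z]] _ ->] g /=.
apply/imsetP; exists (i, (g i y, g i z)); rewrite ?inE //=.
apply/ffunP => j; rewrite conjgE !mulg_ffun invg_ffun.
have [<-|ij] := eqVneq i j; first by rewrite !dfung1_id -conjgE tpermJ.
by rewrite !dfung1_dflt // mul1g mulVg.
Qed.

Theorem perm_tuples_mgf_le (R : realType) (f : tuples -> R) (l D : R) :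
  {in coordinate_transpositions, forall b g, `|f (b * g)%g - f g| <= D} ->
  \sum_g expR (l * f g) <=
    #|{: tuples}|%:R * expR (l * ((\sum_g f g) / #|{: tuples}|%:R)
                     + 2 * (d * n)%:R * l ^+ 2 * D ^+ 2).
Proof.
apply: (group_chain_mgf_le (H := fixes_from_group) (N := (d * n)%N)).
- exact: fixes_from0.
- exact: fixes_from_full.
- exact: fixes_from_sub.
- exact: fixes_from_mul.
- exact: conj_coordinate_transpositions.
Qed.

End PermutationTuples.

(** * Averages over random tuples of permutations *)

Section PermutationAverages.
Variables d n : nat.
Local Notation tuples := {dffun forall j : 'I_d, 'S_n}.

(** The values at i of a uniform tuple form a uniform point of 'I_n ^ d: by
    translation invariance i may be replaced by any tuple t of points, and for
    fixed g the points g_j (t_j) run over everything as t does. *)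
Lemma sum_perm_tuples_eval (V : zmodType) (F : {ffun 'I_d -> 'I_n} -> V) i :
  (\sum_(g : tuples) F [ffun j => g j i]) *+ (n ^ d) =
  (\sum_t F t) *+ #|{: tuples}|.
Proof.
pose shift (t : {ffun 'I_d -> 'I_n}) : tuples := [ffun j => tperm i (t j)].
have shift_sum (t : {ffun 'I_d -> 'I_n}) : \sum_(g : tuples) F [ffun j => g j i] =
    \sum_(g : tuples) F [ffun j => g j (t j)].
  rewrite [RHS](reindex_inj (mulgI (shift t))); apply: eq_bigr => g _.
  by congr F; apply/ffunP => j; rewrite !ffunE permM tpermR.
have shift_all (g : tuples) :
    \sum_(t : {ffun 'I_d -> 'I_n}) F [ffun j => g j (t j)] = \sum_t F t.
  rewrite [RHS](reindex_inj (h := fun t : {ffun 'I_d -> 'I_n} =>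
    [ffun j => g j (t j)])) // => t u /ffunP eq_tu; apply/ffunP => j.
  by have := eq_tu j; rewrite !ffunE => /perm_inj.
rewrite -[(n ^ d)%N](_ : #|{: {ffun 'I_d -> 'I_n}}| = _); last first.
  by rewrite card_ffun !card_ord.
rewrite -sumr_const (eq_bigr _ (fun t _ => shift_sum t)) exchange_big /=.
by under eq_bigr => g _ do rewrite shift_all; rewrite sumr_const.
Qed.

Variable R : realType.
Implicit Type k : 'I_n -> 'I_n -> R.

(** With q a b the sum over s of k (s a) (s b), invariance makes q constant off
    the diagonal (by 2-transitivity) and on it; the hypothesis on 2 k makes the
    diagonal value the larger one. So q i i' is at most the mean of q over all
    pairs, which is the mean of k up to the factor n!. *)
Lemma sum_perm_off_diagonal_le k i i' :
  i != i' -> (forall a b, k a b = k b a) ->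
  (forall a b, 2 * k a b <= k a a + k b b) ->
  (\sum_(s : 'S_n) k (s i) (s i')) * n%:R ^+ 2 <=
  #|{: 'S_n}|%:R * \sum_a \sum_b k a b.
Proof.
move=> ii' k_sym k_psd.
pose q a b := \sum_(s : 'S_n) k (s a) (s b).
have q_shift (r : 'S_n) a b : q (r a) (r b) = q a b.
  rewrite /q [RHS](reindex_inj (mulgI r)).
  by apply: eq_bigr => s _; rewrite !permM.
have q_diag a b : q a a = q b b.
  by rewrite -(q_shift (tperm a b) a a) tpermL.
have q_min a b : q i i' <= q a b.
  have [<-|ab] := eqVneq a b.
    have : 2 * q i i' <= q i i + q i' i'.
      by rewrite /q mulr_sumr -big_split; apply: ler_sum => s _; exact: k_psd.
    by rewrite (q_diag i a) (q_diag i' a); lra.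
  pose r := (tperm a i * tperm (tperm a i b) i')%g.
  have ra : r a = i.
    rewrite permM tpermL tpermD // 1?eq_sym //.
    by rewrite -{1}(tpermL a i) (inj_eq perm_inj).
  have rb : r b = i' by rewrite permM tpermL.
  by rewrite -(q_shift r a b) ra rb.
have q_total : \sum_a \sum_b q a b = #|{: 'S_n}|%:R * \sum_a \sum_b k a b.
  rewrite (eq_bigr _ (fun a _ => exchange_big _ _ _ _ _ _)) exchange_big /=.
  rewrite mulr_natl -sumr_const; apply: eq_bigr => s _.
  rewrite [RHS](reindex_inj (@perm_inj _ s)); apply: eq_bigr => a _.
  by rewrite [RHS](reindex_inj (@perm_inj _ s)).
rewrite -q_total -/(q i i') expr2 mulrA.
rewrite -[n in _ * n%:R](card_ord n) mulr_natr -sumr_const; apply: ler_sum => a _.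
rewrite -[n in _ * n%:R](card_ord n) mulr_natr -sumr_const; apply: ler_sum => b _.
exact: q_min.
Qed.

(** Nonnegativity of k j is what allows the bounds on the coordinates to be
    multiplied. *)
Lemma sum_perm_tuples_gram_le (k : 'I_d -> 'I_n -> 'I_n -> R) (K : 'I_d -> R) :
  (forall j a b, k j a b = k j b a) ->
  (forall j a b, 2 * k j a b <= k j a a + k j b b) ->
  (forall j a b, 0 <= k j a b <= K j) -> (0 < n)%N ->
  \sum_i \sum_i' \sum_(g : tuples) \prod_j k j (g j i) (g j i') <=
  #|{: tuples}|%:R * (n%:R * \prod_j K j +
    n%:R ^+ 2 * \prod_j ((\sum_a \sum_b k j a b) / n%:R ^+ 2)).
Proof.
move=> k_sym k_psd k_bound n_gt0.
have n2_gt0 : 0 < n%:R ^+ 2 :> R by rewrite exprn_gt0 // ltr0n.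
set M := \prod_j ((\sum_a \sum_b k j a b) / n%:R ^+ 2).
have M_ge0 : 0 <= M.
  apply: prodr_ge0 => j _; rewrite divr_ge0 ?(ltW n2_gt0) //.
  by apply: sumr_ge0 => a _; apply: sumr_ge0 => b _; case/andP: (k_bound j a b).
have K_ge0 : 0 <= \prod_j K j.
  apply: prodr_ge0 => j _; have /andP[] := k_bound j (Ordinal n_gt0) (Ordinal n_gt0).
  exact: le_trans.
have card_tuples : #|{: tuples}|%:R = \prod_(j < d) #|{: 'S_n}|%:R :> R.
  rewrite prodr_const card_ord -natrX -[in RHS](card_ord d).
  by congr _%:R; exact: card_ffun.
have diag i : \sum_(g : tuples) \prod_j k j (g j i) (g j i) <=
    #|{: tuples}|%:R * \prod_j K j.
  rewrite mulr_natl -sumr_const; apply: ler_sum => g _.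
  by apply: ler_prod => j _; exact: k_bound.
have off_diag i i' : i != i' ->
    \sum_(g : tuples) \prod_j k j (g j i) (g j i') <= #|{: tuples}|%:R * M.
  move=> ii'.
  have -> : \sum_(g : tuples) \prod_j k j (g j i) (g j i') =
      \prod_j \sum_(s : 'S_n) k j (s i) (s i').
    by rewrite bigA_distr_bigA.
  rewrite card_tuples -big_split; apply: ler_prod => j _; apply/andP; split.
    by apply: sumr_ge0 => s _; case/andP: (k_bound j (s i) (s i')).
  rewrite /= mulrA ler_pdivlMr //; exact: sum_perm_off_diagonal_le.
have bound i i' : \sum_(g : tuples) \prod_j k j (g j i) (g j i') <=
    #|{: tuples}|%:R * ((i == i')%:R * \prod_j K j + M).
  have [<-|ii'] := eqVneq i i'; last by rewrite mul0r add0r; exact: off_diag.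
  by rewrite mul1r mulrDr (le_trans (diag i)) // lerDl mulr_ge0.
have row i : \sum_i' \sum_(g : tuples) \prod_j k j (g j i) (g j i') <=
    #|{: tuples}|%:R * (\prod_j K j + n%:R * M).
  apply: (le_trans (ler_sum _ (fun i' _ => bound i i'))).
  rewrite -mulr_sumr big_split /= -mulr_suml sumr_const card_ord.
  rewrite (bigD1 i) //= eqxx big1 ?addr0 ?mul1r => [|i' /negPf].
    by rewrite -[M *+ n]mulr_natl.
  by rewrite eq_sym => ->.
apply: (le_trans (ler_sum _ (fun i _ => row i))).
rewrite sumr_const card_ord -[X in X <= _]mulr_natl [X in X <= _]mulrCA.
by rewrite mulrDr mulrA expr2.
Qed.

End PermutationAverages.

(** * Inner products *)

Section InnerProduct.
Variables (R : realType) (V : normedModType R) (dot : {dot V for idfun}).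
Hypothesis dot_normE : forall v : V, `|v| ^+ 2 = dot v v.

Let dotC u v : dot u v = dot v u.
Proof. by have := @hermC _ _ _ _ dot u v; rewrite expr0 mul1r. Qed.

Let dotBl u v w : dot (u - v) w = dot u w - dot v w.
Proof. exact: linearBl. Qed.

Let dotBr u v w : dot u (v - w) = dot u v - dot u w.
Proof. exact: linearBr. Qed.

Let dotZl a u v : dot (a *: u) v = a * dot u v.
Proof. exact: linearZl_LR. Qed.

Lemma sqr_normB u v : `|u - v| ^+ 2 = `|u| ^+ 2 - 2 * dot u v + `|v| ^+ 2.
Proof. by rewrite !dot_normE dotBl !dotBr (dotC v u); ring. Qed.

Lemma sqr_norm_sum (I : finType) (v : I -> V) :
  `|\sum_i v i| ^+ 2 = \sum_i \sum_i' dot (v i) (v i').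
Proof.
rewrite dot_normE [LHS]linear_sumlz; apply: eq_bigr => i _.
exact: linear_sumr.
Qed.

Lemma dot_le_norm u v : `|u| <= 1 -> dot u v <= `|v|.
Proof.
move=> u_le1; have [->|v_neq0] := eqVneq v 0.
  by rewrite normr0 -[X in dot u X](subrr u) dotBr subrr.
have v_gt0 : 0 < `|v| by rewrite normr_gt0.
(* Rescaling u to the norm of v makes the square give the bound directly. *)
have := sqr_ge0 `|(`|v| *: u) - v|.
rewrite sqr_normB dotZl normrZ normr_id => expand.
rewrite -(ler_pM2l v_gt0) -expr2.
have : (`|v| * `|u|) ^+ 2 <= `|v| ^+ 2.
  by rewrite exprMn ler_piMr ?sqr_ge0 // expr_le1.
lra.
Qed.

Lemma sum_sqr_norm_centered (T : finType) (v : T -> V) (m : V) :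
  \sum_t v t = #|T|%:R *: m ->
  \sum_t `|v t - m| ^+ 2 = \sum_t `|v t| ^+ 2 - #|T|%:R * `|m| ^+ 2.
Proof.
move=> mean_v; under eq_bigr => t _ do rewrite sqr_normB.
have sum_dot : \sum_t dot (v t) m = #|T|%:R * `|m| ^+ 2.
  by rewrite dot_normE -dotZl -mean_v; apply/esym; exact: linear_sumlz.
rewrite big_split sumrB /= -mulr_sumr sum_dot sumr_const.
rewrite -[_ *+ #|T|]mulr_natl; ring.
Qed.

End InnerProduct.

(** * Embeddings of a sample and of its recombinations *)

Section Embeddings.
Variables (R : realType) (d : nat) (X : 'I_d -> ptopologicalType).
Variables (k : forall j, X j -> X j -> R) (H : rkhs (tensor_kernel k)) (n : nat).
Local Notation dot := (rkhs_dot H).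
Local Notation feature := (rkhs_section H).
Local Notation tuples := {dffun forall j : 'I_d, 'S_n}.
Implicit Types (x y : 'I_n -> prod_topology X) (pi : tuples).

Definition joint_embedding y : H := n%:R^-1 *: \sum_i feature (y i).

Definition marginal_embedding y : H :=
  (n ^ d)%:R^-1 *: \sum_(t : {ffun 'I_d -> 'I_n}) feature (fun j => y (t j) j).

Lemma dot_feature (u v : prod_topology X) :
  dot (feature u) (feature v) = \prod_j k (u j) (v j).
Proof. by rewrite -rkhs_reproducing rkhs_sectionE. Qed.

Lemma dHSIC_le_norm y : dHSIC H y <= `|joint_embedding y - marginal_embedding y|.
Proof.
apply: ge_sup.
  by exists (n%:R^-1 * (\sum_(i < n) rkhs_eval (0 : H) (y i)) - (n ^ d)%:R^-1 *
     (\sum_(i : {ffun 'I_d -> 'I_n}) rkhs_eval (0 : H) (fun j => y (i j) j)));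
     exists (rkhs_eval (0 : H)) => //; exists 0 => //=; rewrite normr0.
move=> _ [_ [f f_le1 <-] <-].
apply: le_trans (dot_le_norm (@rkhs_normE _ _ _ H) _ f_le1).
have dot_scaled_sum (I : finType) (c : R) (u : I -> prod_topology X) :
    dot f (c *: \sum_i feature (u i)) = c * \sum_i rkhs_eval f (u i).
  rewrite [LHS]linearZr_LR /=; congr (_ * _); rewrite [LHS]linear_sumr.
  by apply: eq_bigr => i _; rewrite rkhs_reproducing.
have -> (u v : H) : dot f (u - v) = dot f u - dot f v by exact: linearBr.
by rewrite !dot_scaled_sum.
Qed.

Lemma marginal_embedding_permute pi x :
  marginal_embedding (permute_data pi x) = marginal_embedding x.
Proof.
rewrite /marginal_embedding; congr (_ *: _).
rewrite [RHS](reindex_inj (h := fun t : {ffun 'I_d -> 'I_n} =>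
    [ffun j => pi j (t j)])) => [|t u /ffunP eq_tu].
  by apply: eq_bigr => t _; congr feature; apply: functional_extensionality_dep
    => j; rewrite ffunE.
by apply/ffunP => j; have := eq_tu j; rewrite !ffunE => /perm_inj.
Qed.

Lemma sum_joint_embedding_permute x : (0 < n)%N ->
  \sum_pi joint_embedding (permute_data pi x) =
    #|{: tuples}|%:R *: marginal_embedding x.
Proof.
move=> n_gt0.
have nd_neq0 : (n ^ d)%:R != 0 :> R by rewrite pnatr_eq0 -lt0n expn_gt0 n_gt0.
have n_neq0 : n%:R != 0 :> R by rewrite pnatr_eq0 -lt0n.
pose F (t : {ffun 'I_d -> 'I_n}) := feature (fun j => x (t j) j).
have orbit i : \sum_(pi : tuples) feature (permute_data pi x i) =
    #|{: tuples}|%:R *: marginal_embedding x.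
  have orbit_F : (n ^ d)%:R *: \sum_(pi : tuples) F [ffun j => pi j i] =
      #|{: tuples}|%:R *: \sum_t F t :> H.
    by rewrite !scaler_nat; exact: sum_perm_tuples_eval.
  rewrite /marginal_embedding scalerA mulrC -scalerA -/F -orbit_F scalerA.
  rewrite (mulVf nd_neq0) scale1r; apply: eq_bigr => pi _; congr feature.
  by apply: functional_extensionality_dep => j; rewrite ffunE.
rewrite /joint_embedding -scaler_sumr exchange_big (eq_bigr _ (fun i _ => orbit i)).
by rewrite sumr_const card_ord -[X in _ *: X]scaler_nat scalerA (mulVf n_neq0) scale1r.
Qed.

Hypothesis k_psd : forall j, positive_semidefinite (k (j := j)).

(** Positivity on the two points u, v with the coefficients 1 and -1. *)
Lemma psd_offdiag_le j (u v : X j) : 2 * k u v <= k u u + k v v.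
Proof.
have [k_sym /(_ 2%N (fun i => (-1) ^+ i) (fun i => if i == 0 then u else v))] := k_psd j.
rewrite !big_ord_recl !big_ord0 /= (k_sym v u); lra.
Qed.

Variable K : 'I_d -> R.
Hypothesis k_bound : forall j (u v : X j), 0 <= k u v <= K j.

(** A Gram sum over pairs of tuples of indices is a product of double sums, one
    for each coordinate. *)
Lemma sqr_norm_marginal_embedding x : (0 < n)%N ->
  `|marginal_embedding x| ^+ 2 =
  \prod_j ((\sum_a \sum_b k (x a j) (x b j)) / n%:R ^+ 2).
Proof.
move=> n_gt0; rewrite /marginal_embedding normrZ exprMn.
rewrite (sqr_norm_sum (@rkhs_normE _ _ _ H)) big_split /= prodr_const card_ord.
rewrite mulrC; congr (_ * _); last first.
  by rewrite real_normK ?num_real // exprVn natrX exprVn -!exprM mulnC.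
under eq_bigr => t _ do under eq_bigr => t' _ do rewrite dot_feature.
transitivity (\sum_(t : {ffun 'I_d -> 'I_n}) \prod_j \sum_b k (x (t j) j) (x b j)).
  by apply: eq_bigr => t _; rewrite bigA_distr_bigA.
by rewrite bigA_distr_bigA.
Qed.

(** The off-diagonal part of the Gram expansion is compensated by the squared
    norm of the mean; only the n diagonal terms survive. *)
Lemma sum_sqr_norm_permuted_le x : (0 < n)%N ->
  \sum_pi `|joint_embedding (permute_data pi x) - marginal_embedding x| ^+ 2 <=
  #|{: tuples}|%:R * ((\prod_j K j) / n%:R).
Proof.
move=> n_gt0; have n_neq0 : n%:R != 0 :> R by rewrite pnatr_eq0 -lt0n.
rewrite (sum_sqr_norm_centered (@rkhs_normE _ _ _ H)
  (sum_joint_embedding_permute x n_gt0)).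
have -> : \sum_pi `|joint_embedding (permute_data pi x)| ^+ 2 =
    n%:R ^- 2 * \sum_i \sum_i' \sum_(pi : tuples) \prod_j
      k (x (pi j i) j) (x (pi j i') j).
  under eq_bigr => pi _.
    rewrite normrZ exprMn (sqr_norm_sum (@rkhs_normE _ _ _ H)).
    rewrite real_normK ?num_real // exprVn.
    over.
  rewrite -mulr_sumr exchange_big; congr (_ * _); apply: eq_bigr => i _.
  rewrite exchange_big; apply: eq_bigr => i' _; apply: eq_bigr => pi _.
  by rewrite dot_feature.
have := @sum_perm_tuples_gram_le d n R (fun j a b => k (x a j) (x b j)) K
  (fun j a b => (k_psd j).1 _ _) (fun j a b => psd_offdiag_le _ _)
  (fun j a b => k_bound _ _) n_gt0.
rewrite sqr_norm_marginal_embedding //.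
have n2_gt0 : 0 < n%:R ^- 2 :> R by rewrite invr_gt0 exprn_gt0 // ltr0n.
move=> /(ler_wpM2l (ltW n2_gt0)).
move/le_trans => gram; rewrite lerBlDr; apply: gram.
rewrite le_eqVlt; apply/orP; left; apply/eqP; field.
by [].
Qed.

Lemma norm_feature_le u : `|feature u| <= Num.sqrt (\prod_j K j).
Proof.
rewrite -(ler_pXn2r (n := 2)) ?nnegrE ?sqrtr_ge0 // rkhs_normE dot_feature.
have le_K : \prod_j k (u j) (u j) <= \prod_j K j.
  by apply: ler_prod => j _; exact: k_bound.
rewrite sqr_sqrtr // (le_trans _ le_K) //.
by apply: prodr_ge0 => j _; case/andP: (k_bound (u j) (u j)).
Qed.

(** A coordinate transposition moves at most two points of the permuted sample,
    and two features are at distance at most 2 sqrt (prod K). *)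
Lemma joint_embedding_lipschitz x :
  {in @coordinate_transpositions d n, forall b pi,
   `| `|joint_embedding (permute_data (b * pi)%g x) - marginal_embedding x|
      - `|joint_embedding (permute_data pi x) - marginal_embedding x| |
     <= 4 * Num.sqrt (\prod_j K j) / n%:R}.
Proof.
move=> b /imsetP[[j0 [y z]] _ ->] pi; set b' := dfung1 _.
apply: (le_trans (ler_dist_dist _ _)).
rewrite opprB addrA subrK /joint_embedding -scalerBr normrZ -sumrB.
rewrite ger0_norm ?invr_ge0 // mulrC ler_wpM2r ?invr_ge0 //.
apply: (le_trans (ler_norm_sum _ _ _)).
set S := Num.sqrt _.
apply: (@le_trans _ _ (\sum_i if i \in [set y; z]%SET then 2 * S else 0)).
  apply: ler_sum => i _; case: ifP => [_|]; last first.
    rewrite !inE => /norP[iy iz].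
    suff -> : permute_data (b' * pi)%g x i = permute_data pi x i.
      by rewrite subrr normr0.
    apply: functional_extensionality_dep => j; rewrite /permute_data.
    rewrite mulg_ffun permM /b'.
    have [<-|j0j] := eqVneq j0 j; first by rewrite dfung1_id tpermD // eq_sym.
    by rewrite dfung1_dflt // perm1.
  apply: (le_trans (ler_normB _ _)).
  by rewrite mulr_natl mulr2n lerD ?norm_feature_le.
rewrite -big_mkcond sumr_const -[X in X <= _]mulr_natr.
have card_le : #|[set y; z]%SET|%:R <= 2 :> R by rewrite ler_nat cards2; case: eqP.
have : 0 <= S by rewrite sqrtr_ge0.
nra.
Qed.

End Embeddings.

(** * The tail bound *)

Lemma card_le_sum_expR (R : realType) (T : finType) (E : pred T) (f : T -> R) (c l : R) :
  0 <= l -> (forall t, E t -> c <= f t) ->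
  #|E|%:R <= expR (- (l * c)) * \sum_t expR (l * f t).
Proof.
move=> l_ge0 f_ge; rewrite mulr_sumr -sum1_card natr_sum big_mkcond /=.
apply: ler_sum => t _; rewrite -expRD; case: ifP => [/f_ge c_le|_].
  rewrite -expR0 ler_expR; have := ler_wpM2l l_ge0 c_le; lra.
exact: expR_ge0.
Qed.

Lemma sqr_mean_le (R : realType) (T : finType) (f : T -> R) :
  (0 < #|T|)%N ->
  ((\sum_t f t) / #|T|%:R) ^+ 2 <= (\sum_t f t ^+ 2) / #|T|%:R.
Proof.
move=> T_gt0; set m := _ / _; have card_gt0 : 0 < #|T|%:R :> R by rewrite ltr0n.
rewrite ler_pdivlMr //.
have sum_f : \sum_t f t = m * #|T|%:R by rewrite /m divfK // gt_eqF.
have : 0 <= \sum_t (f t - m) ^+ 2 by apply: sumr_ge0 => t _; exact: sqr_ge0.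
have -> : \sum_t (f t - m) ^+ 2 = \sum_t f t ^+ 2 - m ^+ 2 * #|T|%:R.
  have expand t : (f t - m) ^+ 2 = f t ^+ 2 - 2 * m * f t + m ^+ 2 by ring.
  under eq_bigr => t _ do rewrite expand.
  rewrite big_split sumrB /= sumr_const -[X in _ + X]mulr_natr -mulr_sumr sum_f.
  by ring.
lra.
Qed.

Theorem dHSIC_perm_tail (R : realType) (d n : nat) (X : 'I_d -> ptopologicalType)
    (k : forall j, X j -> X j -> R) (H : rkhs (tensor_kernel k)) (K : 'I_d -> R)
    (x : 'I_n -> prod_topology X) (M : R) :
  (forall j, positive_semidefinite (k j)) ->
  (forall j, 0 < K j) ->
  (forall j (y z : X j), 0 <= k j y z <= K j) ->
  (0 < n)%N -> 1 <= M ->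
  perm_prob R (fun pi => (2 + 32 * d%:R) * Num.sqrt ((\prod_(j < d) K j) / n%:R) * M
                         <= dHSIC H (permute_data pi x))
  <= expR (- M ^+ 2).
Proof.
move=> k_psd K_gt0 k_bound n_gt0 M_ge1.
have n_pos : 0 < n%:R :> R by rewrite ltr0n.
have PK_gt0 : 0 < \prod_j K j by apply: prodr_gt0.
set PK := \prod_j K j in PK_gt0 *; set s := Num.sqrt _; set c := _ * M.
have s_gt0 : 0 < s by rewrite sqrtr_gt0 divr_gt0.
have s_sqr : s ^+ 2 = PK / n%:R by rewrite sqr_sqrtr // ltW // divr_gt0.
pose T : finType := {dffun forall j : 'I_d, 'S_n}.
pose f (pi : T) := `|joint_embedding H (permute_data pi x) - marginal_embedding H x|.
pose m := (\sum_pi f pi) / #|T|%:R.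
have T_card : (0 < #|T|)%N by apply/card_gt0P; exists 1%g.
have T_gt0 : 0 < #|T|%:R :> R by rewrite ltr0n.
have m_ge0 : 0 <= m.
  apply: divr_ge0; last exact: ltW.
  by apply: sumr_ge0 => pi _; exact: normr_ge0.
have m_le : m <= s.
  have : m ^+ 2 <= s ^+ 2.
    apply: (le_trans (sqr_mean_le f T_card)); rewrite ler_pdivrMr // s_sqr mulrC.
    exact: sum_sqr_norm_permuted_le.
  by rewrite ler_pXn2r ?nnegrE ?(ltW s_gt0).
pose D := 4 * Num.sqrt PK / n%:R.
have D_sqr : D ^+ 2 = 16 * s ^+ 2 / n%:R.
  rewrite s_sqr /D !exprMn sqr_sqrtr ?ltW // exprVn; field.
  by rewrite gt_eqF.
have mgf := perm_tuples_mgf_le (f := f) (M / s)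
  (@joint_embedding_lipschitz R d X k H n K k_bound x).
(* The value l = M / s makes the variance term 2 d n l^2 D^2 equal to 32 d M^2,
   which the part 32 d of the constant absorbs; from the remaining
   - 2 M^2, the mean takes back at most M <= M^2. *)
have l_ge0 : 0 <= M / s by rewrite divr_ge0 ?ltW //; lra.
rewrite /perm_prob ler_pdivrMr //.
apply: (le_trans (card_le_sum_expR (T := T) (f := f) (c := c) l_ge0 _)).
  move=> pi /le_trans; apply; apply: (le_trans (dHSIC_le_norm H _)).
  by rewrite marginal_embedding_permute.
apply: (le_trans (ler_wpM2l (expR_ge0 _) mgf)).
rewrite [X in X <= _]mulrCA [X in X <= _]mulrC -expRD (ler_pM2r T_gt0) ler_expR.
rewrite -/D D_sqr -/m.
have -> : 2 * (d * n)%:R * (M / s) ^+ 2 * (16 * s ^+ 2 / n%:R) = 32 * d%:R * M ^+ 2.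
  by rewrite natrM; field; rewrite !gt_eqF.
have -> : M / s * c = (2 + 32 * d%:R) * M ^+ 2 by rewrite /c; field; rewrite gt_eqF.
have : M / s * m <= M by rewrite mulrAC ler_pdivrMr // ler_wpM2l //; lra.
nra.
Qed.

Theorem lemmaF7 (R : realType) (d : nat) (d_ge2 : (2 <= d)%N) :
  exists2 C : R, 0 < C &
  forall (X : 'I_d -> ptopologicalType) (k : forall j, X j -> X j -> R)
    (H : rkhs (tensor_kernel k)) (K : 'I_d -> R) (n : nat)
    (x : 'I_n -> prod_topology X) (alpha : R),
  (forall j, separable (X j)) ->
  (forall j, continuous (fun p : X j * X j => k j p.1 p.2)) ->
  (forall j, bounded_fun (fun p : X j * X j => k j p.1 p.2)) ->
  (forall j, positive_semidefinite (k j)) ->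
  characteristic (tensor_kernel k) ->
  (forall j, 0 < K j) ->
  (forall j (y z : X j), 0 <= k j y z <= K j) ->
  (0 < n)%N ->
  0 < alpha < 1 ->
  perm_prob R
    (fun pi => C * Num.sqrt ((\prod_(j < d) K j) / n%:R)
                 * Num.max (ln alpha^-1 `^ 4^-1)
                     (Num.max (ln alpha^-1 `^ 2^-1) 1)
               <= dHSIC H (permute_data pi x))
  <= alpha.
Proof.
exists (2 + 32 * d%:R); first by have : 0 <= d%:R :> R := ler0n _ _; lra.
move=> X k H K n x alpha _ _ _ k_psd _ K_gt0 k_bound n_gt0 /andP[a_gt0 a_lt1].
set M := Num.max _ _.
have M_ge1 : 1 <= M by rewrite !le_max lexx !orbT.
apply: (le_trans (dHSIC_perm_tail H x k_psd K_gt0 k_bound n_gt0 M_ge1)).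
have L_gt0 : 0 < ln alpha^-1 by rewrite ln_gt0 // invf_gt1.
have sqrt_le : Num.sqrt (ln alpha^-1) <= M.
  by rewrite !le_max powR12_sqrt ?lexx ?orbT // ltW.
have L_le : ln alpha^-1 <= M ^+ 2.
  rewrite -[leLHS]sqr_sqrtr ?(ltW L_gt0) //.
  by rewrite ler_pXn2r ?nnegrE ?sqrtr_ge0 //; lra.
rewrite -[leRHS](lnK (x := alpha)) ?posrE // ler_expR lerNl.
by rewrite -lnV ?posrE.
Qed.
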